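(* Let $(X,d,A)$ be a metric pair such that $(X/A,d_1,[A])$ is separable and not uniformly discrete, let $B=\widehat V(X,A)$, let $(J,\Sigma)$ be admissible covariance data on $B$, let $t>0$, let $R\ge1$ be an integer, and let $u_1,\dots,u_R$ be independent samples from the Gaussian measure $\gamma_\Sigma$ on $\ell^2$. Define $$\widehat k_R(x,y):=\frac1R\sum_{r=1}^R\exp\!\bigl(i\sqrt t\,\langle J(x-y),u_r\rangle_{\ell^2}\bigr),\qquad x,y\in B.$$ Let $S\subset B$ be finite and let $\hat\varepsilon>0$. Then $$\mathbb P\!\left(\max_{x,y\in S}\bigl|\widehat k_R(x,y)-k_{J,\Sigma,t}(x,y)\bigr|>\hat\varepsilon\right)\le4|S|^2\exp\!\left(-\frac{R\hat\varepsilon^2}{4}\right).$$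
   Context: A metric pair $(X,d,A)$ is a metric space with a distinguished subset $A\subseteq X$. Put $d(x,A):=\inf_{a\in A}d(x,a)$ and $d_1(x,y):=\min\bigl(d(x,y),\,d(x,A)+d(y,A)\bigr)$. Let $X/A$ be the quotient collapsing $A$ to a point $[A]$; $d_1$ descends to $X/A$. Standing assumption: $A$ is nonempty and $d_1$ is a genuine metric on $X/A$ (i.e. $d(x,A)>0$ for $x\notin A$). A metric space is uniformly discrete if distances between distinct points are bounded below by some $\varepsilon>0$. $V(X,A):=V(X)/V(A)$ ($V(Y)$ the free real vector space on $Y$) has basis $(e_u)_{u\in X/A\setminus\{[A]\}}$ and norm $\|\sum_uc_ue_u\|_{W_1}=\sup\{\sum_uc_uf(u): f\colon X/A\to\mathbb R,\ f([A])=0,\ \mathrm{Lip}_{d_1}(f)\le1\}$. $B=\widehat V(X,A)$ is its Banach completion (the Lipschitz-free space $\mathcal F(X/A,d_1)$). Admissible covariance data $(J,\Sigma)$: fix a sequence $(\ell_n)_{n\ge1}\subset B^\ast$ with $\|\ell_n\|_{B^\ast}\le1$ that is norming ($\|x\|_{W_1}=\sup_n|\ell_n(x)|$ for all $x\in B$) and a strictly positive $(w_n)\in\ell^2$; $J\colon B\to\ell^2$, $Jx:=(w_n\ell_n(x))_n$. $\Sigma$ is the positive trace-class operator on the real Hilbert space $\ell^2$ with $\Sigma e_n=\sigma_ne_n$ in the standard basis, $\sigma_n\ge0$, $\sum_n\sigma_n<\infty$. $\gamma_\Sigma$ is the centered Gaussian Radon probability measure on $\ell^2$ with $\int e^{i\langle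 h,u\rangle}\,d\gamma_\Sigma(u)=\exp(-\tfrac12\langle\Sigma h,h\rangle)$ for all $h\in\ell^2$. The kernel is $k_{J,\Sigma,t}(x,y)=\mathbb E_{u\sim\gamma_\Sigma}[\exp(i\sqrt t\langle J(x-y),u\rangle)]=\exp\bigl(-\tfrac t2\|\Sigma^{1/2}J(x-y)\|_{\ell^2}^2\bigr)$. *)

(* Defs.v *)
From HB Require Import structures.
From mathcomp Require Import all_boot all_order all_algebra.
From mathcomp Require Import generic_quotient finmap complex.
From mathcomp Require Import all_classical all_reals all_analysis.
From mathcomp Require Import ring lra.

Set Implicit Arguments.
Unset Strict Implicit.
Unset Printing Implicit Defensive.

Import Order.TTheory GRing.Theory Num.Theory.
Import numFieldNormedType.Exports.

Local Open Scope classical_set_scope.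
Local Open Scope ring_scope.

Definition separable_space (T : topologicalType) : Prop :=
  exists2 D : set T, countable D & dense D.

Definition uniformly_discrete (R : realType) (T : metricType R) : Prop :=
  exists2 e : R, 0 < e & forall x y : T, x != y -> e <= mdist x y.

Definition dist_to (R : realType) (T : metricType R) (A : set T) (x : T) : R :=
  inf [set mdist x a | a in A].

(* mp_dist_gt0 makes d1 a genuine metric (not just a pseudometric) on X/A. *)
Record metric_pair (R : realType) := MetricPair {
  mp_space : metricType R ;
  mp_sub : set mp_space ;
  mp_sub_nonempty : mp_sub !=set0 ;
  mp_dist_gt0 : forall x, ~ mp_sub x -> 0 < dist_to mp_sub x
}.

Section quotient.
Context {R : realType} (M : metric_pair R).
Local Notation X := (mp_space M).
Local Notation A := (@mp_sub R M).

Definition d1 (x y : X) : R :=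
  Num.min (mdist x y) (dist_to A x + dist_to A y).

Definition collapse_rel (x y : X) : bool := `[< x = y \/ A x /\ A y >].

Let collapse_refl : reflexive collapse_rel.
Proof. by move=> x; apply/asboolP; left. Qed.

Let collapse_sym : symmetric collapse_rel.
Proof.
by move=> x y; apply/asboolP/asboolP => -[->|[]]; by [left|right].
Qed.

Let collapse_trans : transitive collapse_rel.
Proof.
move=> y x z /asboolP[->//|[Ax Ay]] /asboolP[<-|[_ Az]]; apply/asboolP; by right.
Qed.

Canonical collapse_equiv :=
  EquivRel collapse_rel collapse_refl collapse_sym collapse_trans.

Local Open Scope quotient_scope.

Definition collapse : Type := {eq_quot collapse_rel}.
HB.instance Definition _ := Choice.on collapse.
HB.instance Definition _ := EqQuotient.on collapse.

Lemma collapse_eqP (x y : X) :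
  \pi_collapse x = \pi_collapse y <-> x = y \/ A x /\ A y.
Proof.
split=> [/eqP|h]; first by rewrite eqmodE => /asboolP.
by apply/eqP; rewrite eqmodE; apply/asboolP.
Qed.

Definition collapse_base : collapse :=
  \pi_collapse (projT1 (cid (mp_sub_nonempty M))).

Let dist_lb (x : X) : has_inf [set mdist x a | a in A].
Proof.
split; last by exists 0 => _ [a _ <-]; exact: mdist_ge0.
by have [a Aa] := mp_sub_nonempty M; exists (mdist x a), a.
Qed.

Let dist_to_ge0 (x : X) : 0 <= dist_to A x.
Proof.
apply: lb_le_inf; first exact: (dist_lb x).1.
by move=> _ [a _ <-]; exact: mdist_ge0.
Qed.

Let dist_to_sub (x : X) : A x -> dist_to A x = 0.
Proof.
move=> Ax; apply/eqP; rewrite eq_le dist_to_ge0 andbT.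
rewrite -(mdistxx x); apply: ge_inf; first exact: (dist_lb x).2.
by exists x.
Qed.

Let dist_to_triangle (x y : X) : dist_to A x <= mdist x y + dist_to A y.
Proof.
rewrite -lerBlDl; apply: lb_le_inf; first exact: (dist_lb y).1.
move=> _ [a Aa <-]; rewrite lerBlDl.
apply: le_trans (metric_triangle x y a).
by apply: ge_inf; [exact: (dist_lb x).2|exists a].
Qed.

Let collapse_dist (u v : collapse) : R := d1 (repr u) (repr v).

Let collapse_distxx u : collapse_dist u u = 0.
Proof.
by apply/eqP; rewrite /collapse_dist /d1 mdistxx eq_le ge_min lexx le_min
  lexx addr_ge0.
Qed.

Let collapse_dist_eq0 u v : collapse_dist u v = 0 -> u = v.
Proof.
rewrite /collapse_dist /d1 minEle; case: ifP => _ h.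
  by rewrite -[u]reprK -[v]reprK (mdist_positivity _ _ h).
have /eqP := h; rewrite paddr_eq0// => /andP[/eqP hu /eqP hv].
rewrite -[u]reprK -[v]reprK; apply/collapse_eqP; right.
by split; apply: contrapT => /mp_dist_gt0; rewrite (hu, hv) ltxx.
Qed.

Let collapse_dist_sym u v : collapse_dist u v = collapse_dist v u.
Proof. by rewrite /collapse_dist /d1 metric_sym addrC. Qed.

Let d1_triangle (y x z : X) : d1 x z <= d1 x y + d1 y z.
Proof.
have xyz := metric_triangle x y z.
have := dist_to_triangle x y; have := dist_to_triangle z y.
rewrite (metric_sym z y) => zy xy.
have y0 := dist_to_ge0 y.
rewrite /d1 (minEle (mdist x y)) (minEle (mdist y z)) ge_min.
by case: ifP => _; case: ifP => _; apply/orP; first left; try right; lra.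
Qed.

HB.instance Definition _ := isMetric.Build R collapse
  collapse_distxx collapse_dist_eq0 collapse_dist_sym
  (fun y x z => d1_triangle (repr y) (repr x) (repr z)).

Lemma mdist_collapse (x y : X) :
  mdist (\pi_collapse x : collapse) (\pi_collapse y) = d1 x y.
Proof.
rewrite [LHS]/(d1 (repr (\pi_collapse x)) (repr (\pi_collapse y))).
have d1A a b z : A a -> A b -> d1 a z = d1 b z.
  have d1Az c : A c -> d1 c z = dist_to A z.
    move=> Ac; rewrite /d1 (dist_to_sub Ac) add0r; apply/min_idPr.
    by have := dist_to_triangle z c; rewrite (dist_to_sub Ac) addr0 metric_sym.
  by move=> Aa Ab; rewrite !d1Az.
have d1C a b : d1 a b = d1 b a by rewrite /d1 metric_sym addrC.
have d1r a z : d1 (repr (\pi_collapse a)) z = d1 a z.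
  have /collapse_eqP[->//|[]] : \pi_collapse (repr (\pi_collapse a)) =
    \pi_collapse a by rewrite reprK.
  exact: d1A.
by apply: etrans (d1r _ _) _; rewrite d1C; apply: etrans (d1r _ _) _; exact: d1C.
Qed.

End quotient.

(* V(X)/V(A) has basis (e_u), u ranging over X/A minus the base point; an
   element is represented by its finitely supported family of coordinates,
   extended by 0 at the base point. *)
Section chains.
Context {R : realType} (M : metric_pair R).
Local Notation Q := (collapse M).

Definition chain_pred : pred (Q -> R) :=
  fun c => `[< finite_set [set u | c u != 0] /\ c (collapse_base M) = 0 >].

Lemma chain_submod_closed : submod_closed chain_pred.
Proof.
split.
  apply/asboolP; split=> //.
  by rewrite (_ : mkset _ = set0)// -subset0 => u /=; rewrite eqxx.
move=> a f g /asboolP[finf f0] /asboolP[fing g0]; apply/asboolP; split.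
  apply: (sub_finite_set _ (_ : finite_set ([set u | f u != 0] `|` [set u | g u != 0]))).
    move=> u /= h; apply: contrapT => /not_orP[/negP/negPn/eqP fu /negP/negPn/eqP gu].
    by have : a * f u + g u != 0 := h; rewrite fu gu mulr0 addr0 eqxx.
  by rewrite finite_setU.
have -> : (a *: f + g) (collapse_base M) =
  a * f (collapse_base M) + g (collapse_base M) by [].
by rewrite f0 g0 mulr0 addr0.
Qed.

HB.instance Definition _ :=
  GRing.isSubmodClosed.Build R (Q -> R) chain_pred chain_submod_closed.

Record chain := Chain { coef :> Q -> R ; coefP : coef \in chain_pred }.

HB.instance Definition _ := [isSub for coef].
HB.instance Definition _ := [Choice of chain by <:].
HB.instance Definition _ := [SubChoice_isSubLmodule of chain by <:].

Definition lip1_base (f : Q -> R) : Prop :=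
  f (collapse_base M) = 0 /\ forall u v, `|f u - f v| <= mdist u v.

Definition W1norm (c : chain) : R :=
  sup [set \sum_(u \in [set: Q]) c u * f u | f in lip1_base].

End chains.

(* The Banach completion of V(X,A) is determined up to isometric isomorphism by
   the data below; results are stated for any B carrying them. *)
Record completion (R : realType) (M : metric_pair R)
    (B : completeNormedModType R) := Completion {
  completion_map :> {linear chain M -> B} ;
  completion_isometry : forall c, `|completion_map c| = W1norm c ;
  completion_dense : dense (range completion_map)
}.

Section ell2.
Context {R : realType}.

Definition sqsummable : pred (nat -> R) :=
  fun x => `[< cvgn (series (fun n => x n ^+ 2)) >].

Lemma cvg_series_mul (x y : nat -> R) : x \in sqsummable -> y \in sqsummable ->
  cvgn (series (fun n => x n * y n)).
Proof.
move=> /asboolP cx /asboolP cy; apply: normed_cvg.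
apply: (@series_le_cvg _ _ (fun n => x n ^+ 2 + y n ^+ 2)).
- by move=> n; exact: normr_ge0.
- by move=> n; rewrite addr_ge0// sqr_ge0.
- move=> n; rewrite [leLHS]normrM -(real_normK (num_real (x n))).
  rewrite -(real_normK (num_real (y n))).
  have := normr_ge0 (x n); have := normr_ge0 (y n).
  move: `|x n| `|y n| => a b a0 b0; nra.
- exact: is_cvg_seriesD.
Qed.

Lemma sqsummable_le (x y : nat -> R) (C : R) : (forall n, `|y n| <= C * `|x n|) ->
  x \in sqsummable -> y \in sqsummable.
Proof.
move=> yx /asboolP cx; apply/asboolP.
apply: (@series_le_cvg _ _ (fun n => C ^+ 2 * x n ^+ 2)).
- by move=> n; exact: sqr_ge0.
- by move=> n; rewrite mulr_ge0// sqr_ge0.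
- move=> n; rewrite -(real_normK (num_real (y n))) -(real_normK (num_real (x n))).
  by rewrite -exprMn ler_sqr ?nnegrE// (le_trans _ (yx n)).
- exact: (@is_cvg_seriesZ _ _ (C ^+ 2) cx).
Qed.

Lemma sqsummable_submod_closed : submod_closed sqsummable.
Proof.
split.
  apply/asboolP; rewrite (_ : series _ = cst 0); first exact: is_cvg_cst.
  apply/funext => n; rewrite seriesEnat /= big1// => i _.
  by rewrite [X in X ^+ 2](_ : _ = 0)// expr0n.
move=> a x y hx hy; apply/asboolP.
have cxy := cvg_series_mul hx hy.
move: hx hy => /asboolP cx /asboolP cy.
rewrite (_ : (fun n => _) = (a ^+ 2 *: (fun n => x n ^+ 2) +
   ((a *+ 2) *: (fun n => x n * y n) + (fun n => y n ^+ 2)))).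
  apply: is_cvg_seriesD; first exact: is_cvg_seriesZ.
  by apply: is_cvg_seriesD => //; exact: is_cvg_seriesZ.
apply/funext => n.
suff : (a * x n + y n) ^+ 2 =
  a ^+ 2 * x n ^+ 2 + ((a *+ 2) * (x n * y n) + y n ^+ 2) by [].
by ring.
Qed.

HB.instance Definition _ :=
  GRing.isSubmodClosed.Build R (nat -> R) sqsummable sqsummable_submod_closed.

Record ell2 := Ell2 { ell2_val :> nat -> R ; ell2P : ell2_val \in sqsummable }.

HB.instance Definition _ := [isSub for ell2_val].
HB.instance Definition _ := [Choice of ell2 by <:].
HB.instance Definition _ := [SubChoice_isSubLmodule of ell2 by <:].

Definition dot (x y : ell2) : R := limn (series (fun n => x n * y n)).

Lemma dotC x y : dot x y = dot y x.
Proof. by congr (limn (series _)); apply/funext => n; rewrite mulrC. Qed.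

Lemma dotDl x y z : dot (x + y) z = dot x z + dot y z.
Proof.
rewrite /dot -lim_seriesD; [|exact: cvg_series_mul (ell2P _) (ell2P _)..].
by congr (limn (series _)); apply/funext => n; exact: mulrDl.
Qed.

Lemma dotZl a x y : dot (a *: x) y = a * dot x y.
Proof.
rewrite /dot -[RHS]lim_seriesZ; last exact: cvg_series_mul (ell2P _) (ell2P _).
by congr (limn (series _)); apply/funext => n; exact: esym (mulrA _ _ _).
Qed.

Lemma dotDr x y z : dot z (x + y) = dot z x + dot z y.
Proof. by rewrite dotC dotDl !(dotC z). Qed.

Lemma dotZr a x y : dot y (a *: x) = a * dot y x.
Proof. by rewrite dotC dotZl dotC. Qed.

Lemma sqr_coord_le_dot (x : ell2) n : x n ^+ 2 <= dot x x.
Proof.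
have cx := cvg_series_mul (ell2P x) (ell2P x).
have nd : nondecreasing_seq (series (fun n => x n * x n)).
  by apply: nondecreasing_series => i _ _; rewrite -expr2 sqr_ge0.
apply: le_trans (nondecreasing_cvgn_le nd cx n.+1).
rewrite seriesSr expr2 lerDr seriesEnat.
by apply: sumr_ge0 => i _; rewrite -expr2 sqr_ge0.
Qed.

Lemma dot_ge0 x : 0 <= dot x x.
Proof. by apply: le_trans (sqr_coord_le_dot x 0); rewrite sqr_ge0. Qed.

Lemma dot_eq0 x : dot x x = 0 -> x = 0.
Proof.
move=> x0; apply/val_inj/funext => n; apply/eqP; rewrite -sqrf_eq0 eq_le sqr_ge0.
by rewrite andbT -[leRHS]x0 sqr_coord_le_dot.
Qed.

Lemma cauchy_schwarz x y : dot x y ^+ 2 <= dot x x * dot y y.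
Proof.
have [y0|y0] := eqVneq (dot y y) 0.
  have /dot_eq0 -> := y0; rewrite -(scale0r 0) !dotZr; lra.
have yy : 0 < dot y y by rewrite lt_neqAle eq_sym y0 dot_ge0.
have := dot_ge0 (dot y y *: x + (- dot x y) *: y).
rewrite !(dotDl, dotDr, dotZl, dotZr) (dotC y x).
move: (dot x x) (dot y y) (dot x y) yy => a b c b0.
rewrite (_ : _ + _ = b * (a * b - c ^+ 2)); last by ring.
by rewrite pmulr_rge0// subr_ge0.
Qed.

Definition ell2_norm (x : ell2) : R := Num.sqrt (dot x x).

Let ell2_normD x y : ell2_norm (x + y) <= ell2_norm x + ell2_norm y.
Proof.
rewrite /ell2_norm -[leRHS]ger0_norm ?addr_ge0 ?sqrtr_ge0// -sqrtr_sqr.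
apply: ler_wsqrtr; rewrite sqrrD !sqr_sqrtr ?dot_ge0//.
rewrite !(dotDl, dotDr) (dotC y x) -sqrtrM ?dot_ge0//.
have := ler_wsqrtr (cauchy_schwarz x y); rewrite sqrtr_sqr.
have := ler_norm (dot x y); lra.
Qed.

Let ell2_normZ a x : ell2_norm (a *: x) = `|a| * ell2_norm x.
Proof.
by rewrite /ell2_norm dotZl dotZr mulrA -expr2 sqrtrM ?sqr_ge0// sqrtr_sqr.
Qed.

Let ell2_norm_eq0 x : ell2_norm x = 0 -> x = 0.
Proof.
move=> /eqP; rewrite sqrtr_eq0 => x0; apply: dot_eq0.
by apply/eqP; rewrite eq_le x0 dot_ge0.
Qed.

HB.instance Definition _ :=
  Lmodule_isNormed.Build R ell2 ell2_normD ell2_normZ ell2_norm_eq0.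

Lemma sqr_ell2_norm (x : ell2) : `|x| ^+ 2 = dot x x.
Proof. by rewrite sqr_sqrtr// dot_ge0. Qed.

Let delta_sqsummable n : (fun m => (m == n)%:R : R) \in sqsummable.
Proof.
apply/asboolP.
apply: (is_cvg_near_cst (\sum_(0 <= k < n.+1) ((k == n)%:R ^+ 2 : R))).
exists n.+1 => // m /= nm; rewrite seriesEnat /= (@big_cat_nat _ _ _ n.+1)//=.
rewrite -[RHS]addr0; congr (_ + _); rewrite big_nat big1// => i /andP[ilt _].
by rewrite gtn_eqF// expr0n.
Qed.

Definition std_basis (n : nat) : ell2 := Ell2 (delta_sqsummable n).

Definition bounded_seq (a : nat -> R) : Prop := exists C, forall n, `|a n| <= C.

Section diag.
Variables (a : nat -> R) (ba : bounded_seq a).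

Let diag_sqsummable (x : ell2) : (fun n => a n * x n) \in sqsummable.
Proof.
have [C aC] := ba; apply: (@sqsummable_le x _ C (fun n => _)) (ell2P x).
by move=> n; rewrite normrM ler_wpM2r.
Qed.

Definition diag_op (x : ell2) : ell2 := Ell2 (diag_sqsummable x).

Lemma diag_op_basis n : diag_op (std_basis n) = a n *: std_basis n.
Proof.
apply/val_inj/funext => m; suff : a m * (m == n)%:R = a n * (m == n)%:R by [].
by have [->//|_] := eqVneq m n; rewrite !mulr0.
Qed.

End diag.

End ell2.
Arguments ell2 : clear implicits.

Definition borel_ell2 (R : realType) := g_sigma_algebraType (@open (ell2 R)).

Definition dual_norm (R : realType) (B : normedModType R) (f : B -> R) : \bar R :=
  ereal_sup [set (`|f x|)%:E | x in [set x : B | `|x| <= 1]].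

Record covariance_data (R : realType) (B : normedModType R) := CovarianceData {
  ell : nat -> {linear B -> R^o} ;
  ell_continuous : forall n, continuous (ell n) ;
  ell_norm : forall n, (dual_norm (ell n) <= 1%:E)%E ;
  ell_norming : forall x, `|x| = sup (range (fun n => `|ell n x|)) ;
  weight : ell2 R ;
  weight_gt0 : forall n, 0 < weight n ;
  sigma : nat -> R ;
  sigma_ge0 : forall n, 0 <= sigma n ;
  sigma_summable : cvgn (series sigma)
}.

Section covariance_operators.
Context {R : realType} {B : normedModType R} (D : covariance_data B).

Let ell_le n x : `|ell D n x| <= `|x|.
Proof.
have [->|x0] := eqVneq x 0; first by rewrite linear0 !normr0.
have nx : 0 < `|x| by rewrite normr_gt0.
have : ((`|ell D n (`|x|^-1 *: x)|)%:E <= 1%:E)%E.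
  apply: le_trans (ell_norm D n); apply: ereal_sup_ubound.
  by exists (`|x|^-1 *: x) => //=; rewrite normrZ normfV normr_id mulVf ?gt_eqF.
rewrite lee_fin linearZ [X in `|X|](_ : _ = `|x|^-1 * ell D n x)//.
by rewrite normrM normfV normr_id mulrC ler_pdivrMr// mul1r.
Qed.

Let J_sqsummable x : (fun n => weight D n * ell D n x) \in sqsummable.
Proof.
apply: (@sqsummable_le _ (weight D) _ `|x| (fun n => _)) (ell2P _).
by move=> n; rewrite normrM mulrC ler_wpM2r.
Qed.

Definition J (x : B) : ell2 R := Ell2 (J_sqsummable x).

Let sigma_bounded : bounded_seq (sigma D).
Proof.
have nd : nondecreasing_seq (series (sigma D)).
  by apply: nondecreasing_series => i _ _; exact: sigma_ge0.
exists (limn (series (sigma D))) => n; rewrite ger0_norm ?sigma_ge0//.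
have := nondecreasing_cvgn_le nd (@sigma_summable _ _ D) n.+1.
apply: le_trans.
rewrite seriesSr lerDr seriesEnat.
by apply: sumr_ge0 => i _; exact: sigma_ge0.
Qed.

Let sqrt_sigma_bounded : bounded_seq (fun n => Num.sqrt (sigma D n)).
Proof.
have [C sC] := sigma_bounded; exists (Num.sqrt C) => n.
rewrite ger0_norm ?sqrtr_ge0// ler_wsqrtr//.
by rewrite (le_trans _ (sC n))// ler_norm.
Qed.

Definition Sigma : ell2 R -> ell2 R := diag_op sigma_bounded.

Definition Sigma_half : ell2 R -> ell2 R := diag_op sqrt_sigma_bounded.

Lemma Sigma_basis n : Sigma (std_basis n) = sigma D n *: std_basis n.
Proof. exact: diag_op_basis. Qed.

Lemma Sigma_halfK h : Sigma_half (Sigma_half h) = Sigma h.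
Proof.
apply/val_inj/funext => n /=.
by rewrite mulrA -expr2 sqr_sqrtr// sigma_ge0.
Qed.

Lemma dot_Sigma h : dot (Sigma h) h = `|Sigma_half h| ^+ 2.
Proof.
rewrite sqr_ell2_norm; congr (limn (series _)); apply/funext => n /=.
by rewrite mulrACA -[in RHS]expr2 sqr_sqrtr ?sigma_ge0// mulrA.
Qed.

End covariance_operators.

Definition expi (R : realType) (x : R) : R[i] := (cos x +i* sin x)%C.

Definition cexpectation d (T : measurableType d) (R : realType)
    (P : probability T R) (f : T -> R[i]) : R[i] :=
  ((\int[P]_w complex.Re (f w)) +i* (\int[P]_w complex.Im (f w)))%C.

Definition radon_measure (R : realType) (mu : probability (borel_ell2 R) R) : Prop :=
  forall (A : set (borel_ell2 R)) (e : R), measurable A -> 0 < e ->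
    exists K : set (ell2 R), [/\ compact K, K `<=` A & (mu (A `\` K) < e%:E)%E].

(* A Borel probability measure on l^2 is determined by its characteristic
   function; in particular the measure below is Gaussian and centered. *)
Record gaussian_measure (R : realType) (B : normedModType R)
    (D : covariance_data B) (gamma : probability (borel_ell2 R) R) : Prop := {
  gaussian_radon : radon_measure gamma ;
  gaussian_charfun : forall h : ell2 R,
    cexpectation gamma (fun u => expi (dot h u)) =
    (expR (- (1 / 2) * dot (Sigma D h) h))%:C%C
}.

Section kernels.
Context {R : realType} {B : normedModType R} (D : covariance_data B).

(* Closed form of the kernel; cov_kernelE is its expression as the expectation
   of exp(i sqrt(t) <J(x - y), u>) under the Gaussian measure. *)
Definition cov_kernel (t : R) (x y : B) : R :=
  expR (- (t / 2) * `|Sigma_half D (J D (x - y))| ^+ 2).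

Lemma cov_kernelE (gamma : probability (borel_ell2 R) R) (t : R) (x y : B) :
  gaussian_measure D gamma -> 0 <= t ->
  (cov_kernel t x y)%:C%C =
  cexpectation gamma (fun u => expi (Num.sqrt t * dot (J D (x - y)) u)).
Proof.
move=> [_ charE] t0.
under [in RHS]eq_fun do rewrite -dotZl.
rewrite charE /cov_kernel -dot_Sigma; congr (_%:C)%C; congr expR.
have -> : Sigma D (Num.sqrt t *: J D (x - y)) = Num.sqrt t *: Sigma D (J D (x - y)).
  by apply/val_inj/funext => n /=; exact: mulrCA.
rewrite dotZl dotZr [in RHS]mulrA [_ * (_ * dot _ _)]mulrA.
rewrite [X in _ = X * _](_ : _ = - (1 / 2) * Num.sqrt t ^+ 2); last by ring.
by rewrite sqr_sqrtr//; congr (_ * _); ring.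
Qed.

Definition empirical_kernel (t : R) (N : nat) (u : 'I_N -> ell2 R) (x y : B) :
    R[i] :=
  N%:R^-1 * \sum_(r < N) expi (Num.sqrt t * dot (J D (x - y)) (u r)).

End kernels.

Definition independent_rvs d d' (Omega : measurableType d) (T : measurableType d')
    (R : realType) (P : probability Omega R) (I : finType)
    (X : I -> {RV P >-> T}) : Prop :=
  forall (F : {set I}) (A : I -> set T), (forall i, measurable (A i)) ->
    (P (\bigcap_(i in [set` F]) X i @^-1` A i) =
     \prod_(i in F) P (X i @^-1` A i))%E.

(* Main.v *)
Require Import Defs.
From HB Require Import structures.
From mathcomp Require Import all_boot all_order all_algebra.
From mathcomp Require Import generic_quotient finmap complex.
From mathcomp Require Import all_classical all_reals all_analysis.
From mathcomp Require Import measurable_realfun.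
From mathcomp Require Import ring lra.

Set Implicit Arguments.
Unset Strict Implicit.
Unset Printing Implicit Defensive.

Import Order.TTheory GRing.Theory Num.Theory.
Import numFieldNormedType.Exports.

Local Open Scope classical_set_scope.
Local Open Scope ring_scope.

(** For fixed [x] and [y] the empirical kernel is an average of [N] independent
copies of [expi (Num.sqrt t * dot (J D (x - y)) v)], [v] drawn from the
Gaussian measure, and the kernel is the mean of that random variable
([cov_kernelE]).  The real and imaginary parts are a cosine and a sine, so they
lie in [[-1, 1]], and Hoeffding's inequality bounds the probability that one of
them is off by at least [s] by [2 * expR (- (N * s ^+ 2 / 2))].  If the complex
deviation exceeds [eps] then one of its two parts is at least
[s = eps / sqrt 2] in absolute value, hence the bound
[4 * expR (- (N * eps ^+ 2 / 4))] for one pair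
([empirical_charfun_deviation]); a union bound over the pairs of points of [S]
concludes.

Three ingredients carry Hoeffding's inequality ([hoeffding]): the sharp bound
[expR (s ^+ 2 / 2)] on the moment generating function of a centred variable of
range 2 ([mgf_centered_le]), the factorisation of the expectation of a product
of nonnegative functions of independent variables
([ge0_integral_prod_independent]), and Chernoff's bound.  The mean of a cosine
need not vanish, so the symmetric estimate [cosh s <= expR (s ^+ 2 / 2)] does
not suffice and the exact two-point computation [cgf_pm1_le] is used. *)

(** * Moment generating function of a two-point variable *)

Lemma ge0_derive_ge0 (R : realType) (f df : R -> R) :
  (forall x : R, is_derive x (1 : R) f (df x)) ->
  (forall x, 0 <= x -> 0 <= df x) ->
  f 0 = 0 -> forall s, 0 <= s -> 0 <= f s.
Proof.
move=> fdf df0 f0 s s0.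
have cf : {within `[0, s], continuous f}.
  apply: continuous_subspaceT => x.
  by apply/differentiable_continuous/derivable1_diffP; case: (fdf x).
have [x /itvP xs] := MVT_segment s0 (fun x _ => fdf x) cf.
by rewrite f0 !subr0 => ->; rewrite mulr_ge0// df0// xs.
Qed.

(** The left-hand side is [phi s = E (expR (s * Z))] for the variable [Z] with
values [1] and [-1] and mean [m].  The derivative of [ln phi] is
[psi / phi], which equals [m] at [0], and its second derivative
[1 - (psi / phi) ^+ 2] is at most [1]; integrating twice gives
[ln (phi s) <= m * s + s ^+ 2 / 2]. *)
Lemma cgf_pm1_le (R : realType) (m s : R) : -1 <= m <= 1 -> 0 <= s ->
  (1 + m) / 2 * expR s + (1 - m) / 2 * expR (- s) <= expR (m * s + s ^+ 2 / 2).
Proof.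
move=> /andP[m1 m2] s0.
pose phi (x : R) : R := (1 + m) / 2 * expR x + (1 - m) / 2 * expR (- x).
pose psi (x : R) : R := (1 + m) / 2 * expR x - (1 - m) / 2 * expR (- x).
have dexpN (x : R) : is_derive x (1 : R) (fun y => expR (- y)) (- expR (- x)).
  have := is_derive1_comp (is_derive_expR (- x)) (is_deriveNid x 1).
  by rewrite mulrN1.
have dphi (x : R) : is_derive x (1 : R) phi (psi x).
  by apply: is_derive_eq; rewrite /psi /GRing.scale /=; ring.
have dpsi (x : R) : is_derive x (1 : R) psi (phi x).
  by apply: is_derive_eq; rewrite /phi /GRing.scale /=; ring.
have phi_gt0 x : 0 < phi x.
  have := expR_gt0 x; have := expR_gt0 (- x); rewrite /phi.
  move: (expR x) (expR _) => a b a0 b0.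
  nra.
have phi_neq0 x : phi x != 0 by rewrite gt_eqF.
have phi0 : phi 0 = 1 by rewrite /phi oppr0 expR0; field.
have psi0 : psi 0 = m by rewrite /psi oppr0 expR0; field.
(* [G] is the derivative of the gap [m * s + s ^+ 2 / 2 - ln (phi s)], and
   [(psi / phi) ^+ 2] is the derivative of [G]. *)
pose G x := m + x - psi x / phi x.
have G_ge0 x : 0 <= x -> 0 <= G x.
  apply: (@ge0_derive_ge0 _ G (fun x => (psi x / phi x) ^+ 2)).
  - move=> y; have dphiV := is_deriveV (phi_neq0 y) (dphi y).
    by apply: is_derive_eq; rewrite /GRing.scale /=; field.
  - by move=> y _; rewrite sqr_ge0.
  - by rewrite /G phi0 psi0; field.
suff : 0 <= m * s + s ^+ 2 / 2 - ln (phi s).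
  by rewrite subr_ge0 -ler_expR lnK ?posrE.
apply: (@ge0_derive_ge0 _ (fun x => m * x + x ^+ 2 / 2 - ln (phi x)) G) => //.
- move=> x; have dln := is_derive1_comp (is_derive1_ln (phi_gt0 x)) (dphi x).
  by apply: is_derive_eq; rewrite /G /GRing.scale /=; field.
- by rewrite phi0 ln1; field.
Qed.

(** * Expectations of products of independent variables *)

Import HBNNSimple.

(** The measures with densities [Z1] and [Z2], pushed forward by [V], agree on
measurable sets, hence integrate every nonnegative function equally: the
integral of [f] is the limit of the integrals of its simple approximations,
which only involve integrals of indicators. *)
Lemma ge0_eq_integral_weight d d' (Omega : measurableType d)
    (T : measurableType d') (R : realType) (P : {measure set Omega -> \bar R})
    (V : {mfun Omega >-> T}) (Z1 Z2 : Omega -> R) (f : T -> R) :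
  measurable_fun setT Z1 -> (forall w, 0 <= Z1 w) ->
  measurable_fun setT Z2 -> (forall w, 0 <= Z2 w) ->
  measurable_fun setT f -> (forall x, 0 <= f x) ->
  (forall A, measurable A ->
    (\int[P]_w (\1_A (V w) * Z1 w)%:E = \int[P]_w (\1_A (V w) * Z2 w)%:E)%E) ->
  (\int[P]_w (f (V w) * Z1 w)%:E = \int[P]_w (f (V w) * Z2 w)%:E)%E.
Proof.
move=> mZ1 Z1_ge0 mZ2 Z2_ge0 mf f_ge0 indic_eq.
have mV : measurable_fun setT V by [].
have mEf : measurable_fun [set: T] (EFin \o f).
  exact/measurable_EFinP.
pose h := nnsfun_approx measurableT mEf.
have mindicV A : measurable A ->
    measurable_fun setT (fun w => \1_A (V w) : R).
  move=> mA; apply: (measurableT_comp _ mV); exact: measurable_indic.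
(* The right-hand side depends on [Z] through integrals of indicators only. *)
have approx (Z : Omega -> R) : measurable_fun setT Z -> (forall w, 0 <= Z w) ->
    (\int[P]_w (f (V w) * Z w)%:E = limn (fun n => \sum_(y \in range (h n))
      y%:E * \int[P]_w (\1_(h n @^-1` [set y]) (V w) * Z w)%:E))%E.
  move=> mZ Z_ge0.
  transitivity (\int[P]_w limn (fun n => (h n (V w) * Z w)%:E))%E.
    apply: eq_integral => w _; apply/esym/cvg_lim => //.
    under eq_fun do rewrite EFinM.
    rewrite EFinM; apply: cvgeZr => //.
    exact: (cvg_nnsfun_approx measurableT mEf (fun x _ => f_ge0 x) Logic.I).
  rewrite monotone_convergence//; last 3 first.
  - move=> n; apply/measurable_EFinP/measurable_funM => //.
    exact: measurableT_comp.
  - by move=> n w _; rewrite lee_fin mulr_ge0.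
  - move=> w _ n m nm; rewrite lee_fin ler_wpM2r//.
    exact/lefP/nd_nnsfun_approx.
  apply: congr_lim; apply/funext => n.
  transitivity (\int[P]_w \sum_(y \in range (h n))
      (y%:E * (\1_(h n @^-1` [set y]) (V w) * Z w)%:E))%E.
    apply: eq_integral => w _; rewrite (fimfunE (h n)).
    rewrite !fsbig_finite//= mulr_suml -sumEFin.
    by apply: eq_bigr => y _; rewrite -mulrA.
  have mterm y : measurable_fun setT
      (fun w => (\1_(h n @^-1` [set y]) (V w) * Z w)%:E).
    by apply/measurable_EFinP/measurable_funM => //; exact: mindicV.
  rewrite ge0_integral_fsum//; last 2 first.
  - by move=> y; exact: measurable_funeM.
  - move=> y w _; rewrite lee_fin indicE.
    have [/set_mem <-|_] := boolP (V w \in _); last by rewrite mul0r mulr0.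
    by rewrite !mulr_ge0.
  apply: eq_fsbigr => y /set_mem [x _ <-].
  rewrite ge0_integralZl ?lee_fin// => w _; by rewrite lee_fin mulr_ge0.
rewrite !approx//; apply: congr_lim; apply/funext => n.
by apply: eq_fsbigr => y _; rewrite indic_eq.
Qed.

(** When all the [g i] are indicators this is the product rule for events.
Indicators are then replaced by the [g i] one index at a time: with all the
other factors fixed, both sides are the integral of a function of [X j] against
a weight (the product of the other factors on the left, the constant product of
their expectations on the right), and [ge0_eq_integral_weight] reduces the
equality to the case where that function is an indicator.  Finiteness of the
expectations makes the constant weight a real number. *)
Lemma ge0_integral_prod_independent d d' (Omega : measurableType d)
    (T : measurableType d') (R : realType) (P : probability Omega R)
    (I : finType) (X : I -> {RV P >-> T}) (g : I -> T -> R) :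
  independent_rvs X ->
  (forall i, measurable_fun setT (g i)) -> (forall i x, 0 <= g i x) ->
  (forall i, \int[P]_w (g i (X i w))%:E < +oo)%E ->
  (\int[P]_w (\prod_i g i (X i w))%:E = \prod_i \int[P]_w (g i (X i w))%:E)%E.
Proof.
move=> indepX mg0 g0_ge0 g0_fin.
have mpreX i A : measurable A -> measurable (X i @^-1` A).
  by move=> mA; rewrite -[_ @^-1` _]setTI; exact: measurable_funPT.
have mcompX i (f : T -> R) : measurable_fun setT f ->
    measurable_fun setT (fun w => f (X i w)).
  by move=> mf; exact: measurableT_comp.
(* The list [s] contains the indices whose function may be arbitrary. *)
suff main (s : seq I) (f : I -> T -> R) :
    (forall i, i \notin s -> exists2 A, measurable A & f i = \1_A) ->
    (forall i, measurable_fun setT (f i)) -> (forall i x, 0 <= f i x) ->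
    (forall i, \int[P]_w (f i (X i w))%:E < +oo)%E ->
    (\int[P]_w (\prod_i f i (X i w))%:E = \prod_i \int[P]_w (f i (X i w))%:E)%E.
  by apply: (main (enum I)) => // i; rewrite mem_enum.
elim: s f => [|j s IHs] f f_indic mf f_ge0 f_fin.
  have /choice [A AP] : forall i, exists A, measurable A /\ f i = \1_A.
    by move=> i; have [//|A mA fA] := f_indic i; exists A.
  have mA i : measurable (A i) by have [] := AP i.
  have -> : f = fun i => \1_(A i) by apply/funext => i; have [] := AP i.
  transitivity (P (\bigcap_(i in [set` [set: I]%SET]) X i @^-1` A i)).
    rewrite -[X in P X]setIT -integral_indic//; last first.
      apply: fin_bigcap_measurable => // i _; exact: mpreX.
    apply: eq_integral => w _; congr EFin; rewrite indicE.
    have [/set_mem/= wA|/negP wA] := boolP (w \in _).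
      rewrite big1// => i _; rewrite indicE mem_set//=.
      by apply: wA; rewrite /= finset.in_setT.
    have [i Ai] : exists i, ~ A i (X i w).
      apply/existsNP => h; apply: wA; apply/mem_set => i _; exact: h.
    by rewrite (bigD1 i)//= indicE memNset// mul0r.
  rewrite indepX//; apply: eq_big => [i|i _]; first by rewrite finset.in_setT.
  by rewrite -[X i @^-1` _]setIT -integral_indic//; exact: mpreX.
have Pprod_ge0 w : 0 <= \prod_(i | i != j) f i (X i w) by exact: prodr_ge0.
have mfX i := mcompX i _ (mf i).
have int_ge0 i : (0 <= \int[P]_w (f i (X i w))%:E)%E.
  by apply: integral_ge0 => w _; rewrite lee_fin.
have int_fin i : (\int[P]_w (f i (X i w))%:E)%E \is a fin_num.
  by rewrite ge0_fin_numE.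
pose c := \prod_(i | i != j) fine (\int[P]_w (f i (X i w))%:E)%E.
have cE : c%:E = (\prod_(i | i != j) \int[P]_w (f i (X i w))%:E)%E.
  by rewrite -prodEFin; apply: eq_bigr => i _; rewrite fineK.
have c_ge0 : 0 <= c by apply: prodr_ge0 => i _; rewrite fine_ge0.
rewrite [RHS](bigD1 j)//= -cE -ge0_integralZr//; last 2 first.
- by apply/measurable_EFinP.
- by move=> w _; rewrite lee_fin.
under [LHS]eq_integral do rewrite (bigD1 j)//=.
under [RHS]eq_integral do rewrite -EFinM.
apply: (@ge0_eq_integral_weight _ _ _ _ _ P (X j) _ (cst c) (f j)) => //.
  by under eq_fun do rewrite -big_filter; exact: measurable_prod.
move=> A mA.
pose f' i := if i == j then \1_A else f i : T -> R.
have f'j : f' j = \1_A by rewrite /f' eqxx.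
have f'ne i : i != j -> f' i = f i by rewrite /f' => /negPf ->.
transitivity (\int[P]_w (\prod_i f' i (X i w))%:E)%E.
  apply: eq_integral => w _; rewrite [in RHS](bigD1 j)//= f'j.
  congr ((_ * _)%:E).
  by apply: eq_bigr => i ij; rewrite f'ne.
have indic_le1 : (\int[P]_w (\1_A (X j w) : R)%:E < +oo)%E.
  rewrite [ltLHS](_ : _ = P (X j @^-1` A)).
    by rewrite (le_lt_trans (probability_le1 _ _)) ?ltry//; exact: mpreX.
  by rewrite -[X j @^-1` _]setIT -integral_indic//; exact: mpreX.
rewrite IHs.
- rewrite (bigD1 j)//= f'j.
  under [in LHS]eq_bigr => i ij do rewrite f'ne//.
  rewrite -cE -ge0_integralZr//.
  by apply/measurable_EFinP/(mcompX _ \1_A); exact: measurable_indic.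
- move=> i /= ins; have [->|ij] := eqVneq i j; first by exists A.
  by rewrite f'ne//; apply: f_indic; rewrite inE negb_or ij.
- move=> i; have [->|ij] := eqVneq i j; last by rewrite f'ne.
  by rewrite f'j; exact: measurable_indic.
- move=> i x; have [->|ij] := eqVneq i j; last by rewrite f'ne.
  by rewrite f'j.
- by move=> i; have [->|ij] := eqVneq i j; rewrite ?f'j// f'ne.
Qed.

(** * Hoeffding's inequality *)

Lemma measurable_superlevel d (Omega : measurableType d) (R : realType)
    (Y : Omega -> R) (c : R) : measurable_fun setT Y ->
  measurable [set w | c <= Y w].
Proof.
move=> mY; rewrite -[X in measurable X]setTI.
rewrite (_ : [set w | _] = Y @^-1` `[c, +oo[); first exact: mY.
by apply/seteqP; split => w /=; rewrite in_itv/= andbT.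
Qed.

Lemma measurable_strict_superlevel d (Omega : measurableType d) (R : realType)
    (Y : Omega -> R) (c : R) : measurable_fun setT Y ->
  measurable [set w | c < Y w].
Proof.
move=> mY; rewrite -[X in measurable X]setTI.
rewrite (_ : [set w | _] = Y @^-1` `]c, +oo[); first exact: mY.
by apply/seteqP; split => w /=; rewrite in_itv/= andbT.
Qed.

Lemma measurable_bigmaxr d (Omega : measurableType d) (R : realType)
    (I : Type) (s : seq I) (f : I -> Omega -> R) :
  (forall i, measurable_fun setT (f i)) ->
  measurable_fun setT (fun w => \big[Num.max/0]_(i <- s) f i w).
Proof.
move=> mf; elim: s => [|i s IHs].
  by under eq_fun do rewrite big_nil; exact: measurable_cst.
by under eq_fun do rewrite big_cons; exact: measurable_maxr.
Qed.

Lemma probability_bounded_integrable d (Omega : measurableType d)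
    (R : realType) (P : probability Omega R) (C : R) (Y : Omega -> R) :
  measurable_fun setT Y -> (forall w, `|Y w| <= C) ->
  P.-integrable setT (EFin \o Y).
Proof.
move=> mY YC; apply: measurable_bounded_integrable => //.
  by rewrite (le_lt_trans (probability_le1 P _)) ?ltry.
exists C; split; first exact: num_real.
by move=> c Cc w _; apply: le_trans (YC w) (ltW Cc).
Qed.

Lemma expR_chord_le (R : realType) (s y : R) : -1 <= y <= 1 ->
  expR (s * y) <= (1 + y) / 2 * expR s + (1 - y) / 2 * expR (- s).
Proof.
move=> /andP[y1 y2].
have t0 : 0 <= (1 + y) / 2 by lra.
have t1 : (1 + y) / 2 <= 1 by lra.
have := convex_expR (Itv01 t0 t1) s (- s); rewrite !convRE/= /unstable.onem.
have -> : 1 - (1 + y) / 2 = (1 - y) / 2 by field.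
by have -> : (1 + y) / 2 * s + (1 - y) / 2 * - s = s * y by field.
Qed.

(** By convexity, [expR] lies below its chord on [[-s, s]]; the expectation of
the chord at [s * Y] depends on [Y] only through its mean, so it is the one
computed for a variable with values in [{-1, 1}] and bounded in
[cgf_pm1_le]. *)
Lemma mgf_centered_le d (Omega : measurableType d) (R : realType)
    (P : probability Omega R) (Y : Omega -> R) (s : R) :
  measurable_fun setT Y -> (forall w, `|Y w| <= 1) -> 0 <= s ->
  \int[P]_w expR (s * (Y w - \int[P]_v Y v)) <= expR (s ^+ 2 / 2).
Proof.
move=> mY Y1 s0; set m := \int[P]_v Y v.
have intY := probability_bounded_integrable P mY Y1.
have int_cst c : P.-integrable setT (EFin \o (fun=> c)).
  by apply: (@probability_bounded_integrable _ _ _ P `|c|).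
have cst_int (c : R) : \int[P]_w c = c.
  rewrite Rintegral_cst// [X in fine X](_ : _ = 1%E) ?mulr1//.
  exact: probability_setT.
have m1 : -1 <= m <= 1.
  apply/andP; split.
    rewrite -[leLHS](cst_int (-1)).
    apply: le_Rintegral => // w _.
    by have := Y1 w; rewrite ler_norml => /andP[].
  rewrite -[leRHS](cst_int 1).
  apply: le_Rintegral => // w _.
  by have := Y1 w; rewrite ler_norml => /andP[].
(* [a + b * Y] is the chord, multiplied by the centring factor
   [expR (- (s * m))]. *)
pose a := expR (- (s * m)) * ((expR s + expR (- s)) / 2).
pose b := expR (- (s * m)) * ((expR s - expR (- s)) / 2).
have intbY : P.-integrable setT (EFin \o (fun w => b * Y w)).
  apply: (@probability_bounded_integrable _ _ _ P `|b|) => [|w].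
    exact: measurable_funM.
  by rewrite normrM ler_piMr.
apply: (@le_trans _ _ (\int[P]_w (a + b * Y w))).
  apply: le_Rintegral => //.
  - apply: (@probability_bounded_integrable _ _ _ P (expR (s * (1 - m)))).
      apply: measurableT_comp => //; apply: measurable_funM => //.
      exact: measurable_funB.
    move=> w; rewrite ger0_norm ?expR_ge0// ler_expR ler_wpM2l// lerD2r.
    by have := Y1 w; rewrite ler_norml => /andP[].
  - apply: (@probability_bounded_integrable _ _ _ P (`|a| + `|b|)) => [|w].
      by apply: measurable_funD => //; exact: measurable_funM.
    by rewrite (le_trans (ler_normD _ _))// lerD2l normrM ler_piMr.
  - move=> w _; rewrite mulrBr expRD mulrC.
    have := @expR_chord_le _ s (Y w); rewrite -ler_norml => /(_ (Y1 w)).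
    move=> /(ler_wpM2l (expR_ge0 (- (s * m)))) /le_trans; apply.
    by rewrite le_eqVlt; apply/orP; left; apply/eqP; rewrite /a /b; field.
rewrite RintegralD// RintegralZl// cst_int -/m.
have := cgf_pm1_le m1 s0.
move=> /(ler_wpM2l (expR_ge0 (- (s * m)))); rewrite -expRD.
have -> : - (s * m) + (m * s + s ^+ 2 / 2) = s ^+ 2 / 2 by field.
apply: le_trans; rewrite le_eqVlt; apply/orP; left; apply/eqP.
by rewrite /a /b; field.
Qed.

(** Chernoff's bound with exponent [s]: this is the minimiser of
[- r * s + r ^+ 2 / 2], which is the exponent per variable given by
[mgf_centered_le] for a general [r]. *)
Lemma hoeffding_upper d d' (Omega : measurableType d) (T : measurableType d')
    (R : realType) (P : probability Omega R) (I : finType)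
    (X : I -> {RV P >-> T}) (f : T -> R) (m s : R) :
  independent_rvs X -> measurable_fun setT f -> (forall x, `|f x| <= 1) ->
  (forall i, \int[P]_w f (X i w) = m) -> 0 < s ->
  (P [set w | #|I|%:R * s <= \sum_i (f (X i w) - m)]%R <=
   (expR (- (#|I|%:R * s ^+ 2 / 2)))%:E)%E.
Proof.
move=> indepX mf f1 fm s0.
have mfX i : measurable_fun setT (fun w => f (X i w)).
  exact: measurableT_comp.
have mY : measurable_fun setT (fun w => \sum_i (f (X i w) - m)).
  by apply: measurable_sum => i; exact: measurable_funB.
pose Y : {RV P >-> R} := mfun_Sub (mem_set mY).
apply: le_trans (chernoff Y (#|I|%:R * s) s0) _.
pose g x := expR (s * (f x - m)).
have mg : measurable_fun setT g.
  apply: measurableT_comp => //; apply: measurable_funM => //.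
  exact: measurable_funB.
have int_g i : P.-integrable setT (EFin \o (fun w => g (X i w))).
  apply: (@probability_bounded_integrable _ _ _ P (expR (s * (1 - m)))).
    exact: measurableT_comp.
  move=> w; rewrite /g ger0_norm ?expR_ge0// ler_expR.
  rewrite ler_wpM2l ?(ltW s0)// lerD2r.
  by have := f1 (X i w); rewrite ler_norml => /andP[].
have gE i : (\int[P]_w (g (X i w))%:E = (\int[P]_w g (X i w))%:E)%E.
  by rewrite fineK//; exact: (integrable_fin_num _ (int_g i)).
have -> : ('M_P Y s = (\prod_i \int[P]_w g (X i w))%:E)%E.
  rewrite -prodEFin; under [RHS]eq_bigr do rewrite -gE.
  rewrite -(@ge0_integral_prod_independent _ _ _ _ _ P _ X (fun=> g))//.
  - rewrite /mmt_gen_fun unlock; apply: eq_integral => w _ /=.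
    rewrite mulr_suml expR_sum; congr EFin.
    by apply: eq_bigr => i _; rewrite mulrC.
  - by move=> _ x; exact: expR_ge0.
  - by move=> i; rewrite gE ltry.
rewrite -EFinM lee_fin.
apply: (@le_trans _ _
    (expR (s ^+ 2 / 2) ^+ #|I| * expR (- (s * (#|I|%:R * s))))).
  rewrite ler_wpM2r ?expR_ge0// -prodr_const; apply: ler_prod => i _.
  rewrite Rintegral_ge0/=; last by move=> w _; exact: expR_ge0.
  rewrite /g -(fm i) mgf_centered_le//; exact: ltW.
rewrite -expRM_natl -expRD.
by rewrite le_eqVlt; apply/orP; left; apply/eqP; congr expR; field.
Qed.

(** The lower tail is the upper tail of [- f]. *)
Lemma hoeffding d d' (Omega : measurableType d) (T : measurableType d')
    (R : realType) (P : probability Omega R) (I : finType)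
    (X : I -> {RV P >-> T}) (f : T -> R) (m s : R) :
  independent_rvs X -> measurable_fun setT f -> (forall x, `|f x| <= 1) ->
  (forall i, \int[P]_w f (X i w) = m) -> 0 < s ->
  (P [set w | #|I|%:R * s <= `|\sum_i (f (X i w) - m)| ]%R <=
   (2 * expR (- (#|I|%:R * s ^+ 2 / 2)))%:E)%E.
Proof.
move=> indepX mf f1 fm s0.
have mfX i : measurable_fun setT (fun w => f (X i w)).
  exact: measurableT_comp.
have mY : measurable_fun setT (fun w => \sum_i (f (X i w) - m)).
  by apply: measurable_sum => i; exact: measurable_funB.
have mNY : measurable_fun setT (fun w => \sum_i (- f (X i w) - - m)).
  apply: measurable_sum => i; apply: measurable_funB => //.
  exact: measurableT_comp.
rewrite (_ : [set w | _] =
    [set w | #|I|%:R * s <= \sum_i (f (X i w) - m)] `|`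
    [set w | #|I|%:R * s <= \sum_i (- f (X i w) - - m)]); last first.
  apply/seteqP; split => w /=;
    under [in X in _ \/ X]eq_bigr do rewrite -opprD; rewrite sumrN ler_normr.
    by move=> /orP.
  by move=> ?; apply/orP.
apply: (le_trans (measureU2 _ _ _)); [exact: measurable_superlevel..|].
rewrite mulrDl mul1r EFinD; apply: leeD; first exact: hoeffding_upper.
apply: (@hoeffding_upper _ _ _ _ _ P I X (fun x => - f x) (- m)) => //.
- exact: measurableT_comp.
- by move=> x; rewrite normrN.
- move=> i; rewrite -(fm i) -mulN1r -RintegralZl//.
    by apply: eq_Rintegral => w _; rewrite mulN1r.
  exact: (probability_bounded_integrable P (mfX i) (fun w => f1 _)).
Qed.

(** * Empirical characteristic functions *)

Lemma empirical_mean_expiE (R : realType) (N : nat) (th : 'I_N -> R) :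
  N%:R^-1 * \sum_(r < N) expi (th r) =
  ((N%:R^-1 * \sum_(r < N) cos (th r)) +i*
   (N%:R^-1 * \sum_(r < N) sin (th r)))%C.
Proof.
have -> : \sum_(r < N) expi (th r) =
    ((\sum_(r < N) cos (th r)) +i* (\sum_(r < N) sin (th r)))%C.
  by elim/big_rec3: _ => // r a b c _ ->.
rewrite -(rmorph_nat (@real_complex R)) -fmorphV.
by apply/eqP; rewrite eq_complex /= !mul0r subr0 addr0 !eqxx.
Qed.

Lemma measurable_empirical_deviation d (Omega : measurableType d)
    (R : realType) (N : nat) (th : 'I_N -> Omega -> R) (z : R[i]) :
  (forall r, measurable_fun setT (th r)) ->
  measurable_fun setT
    (fun w => Normc.normc (N%:R^-1 * \sum_(r < N) expi (th r w) - z)).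
Proof.
move=> mth; case: z => a b.
under eq_fun do rewrite empirical_mean_expiE /=.
have msqrt : measurable_fun setT (@Num.sqrt R).
  by apply: continuous_measurable_fun; exact: sqrt_continuous.
apply: (measurableT_comp msqrt).
by apply: measurable_funD; apply: measurable_funX; apply: measurable_funB => //;
  apply: measurable_funM => //; apply: measurable_sum => r;
  apply: measurableT_comp => //; apply: continuous_measurable_fun;
  [exact: continuous_cos|exact: continuous_sin].
Qed.

(** The threshold [s] with [s ^+ 2 = eps ^+ 2 / 2] is the largest one for which
a complex number of modulus greater than [eps] has a real or an imaginary part
of absolute value at least [s]. *)
Lemma empirical_charfun_deviation d d' (Omega : measurableType d)
    (T : measurableType d') (R : realType) (P : probability Omega R)
    (N : nat) (X : 'I_N -> {RV P >-> T}) (th : T -> R) (z : R[i]) (eps : R) :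
  (0 < N)%N -> independent_rvs X -> measurable_fun setT th ->
  (forall r, cexpectation P (fun w => expi (th (X r w))) = z) -> 0 < eps ->
  (P [set w | eps < Normc.normc
        (N%:R^-1 * (\sum_(r < N) expi (th (X r w))) - z)]%R <=
   (4 * expR (- (N%:R * eps ^+ 2 / 4)))%:E)%E.
Proof.
move=> N0 indepX mth + eps0; case: z => a b Eth.
pose s := Num.sqrt (eps ^+ 2 / 2).
have s0 : 0 < s by rewrite sqrtr_gt0 divr_gt0// exprn_gt0.
have s2 : s ^+ 2 = eps ^+ 2 / 2 by rewrite sqr_sqrtr// divr_ge0// sqr_ge0.
have mcos : measurable_fun setT (fun x => cos (th x)).
  apply: measurableT_comp => //.
  by apply: continuous_measurable_fun; exact: continuous_cos.
have msin : measurable_fun setT (fun x => sin (th x)).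
  apply: measurableT_comp => //.
  by apply: continuous_measurable_fun; exact: continuous_sin.
have Ecos r : \int[P]_w cos (th (X r w)) = a by have [] := Eth r.
have Esin r : \int[P]_w sin (th (X r w)) = b by have [] := Eth r.
have normcos x : `|cos (th x)| <= 1 by rewrite ler_norml cos_geN1 cos_le1.
have normsin x : `|sin (th x)| <= 1 by rewrite ler_norml sin_geN1 sin_le1.
have Hcos := hoeffding indepX mcos normcos Ecos s0.
have Hsin := hoeffding indepX msin normsin Esin s0.
have mdev (f : T -> R) (c : R) : measurable_fun setT f ->
    measurable [set w | #|'I_N|%:R * s <= `|\sum_r (f (X r w) - c)|].
  move=> mf; apply: measurable_superlevel.
  apply: measurableT_comp => //; apply: measurable_sum => r.
  by apply: measurable_funB => //; exact: measurableT_comp.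
apply: (@le_trans _ _ (P (
    [set w | #|'I_N|%:R * s <= `|\sum_r (cos (th (X r w)) - a)|] `|`
    [set w | #|'I_N|%:R * s <= `|\sum_r (sin (th (X r w)) - b)|]))).
  apply: le_measure.
  - have mthX r : measurable_fun setT (fun w => th (X r w)).
      exact: measurableT_comp.
    rewrite inE; apply: measurable_strict_superlevel.
    exact: measurable_empirical_deviation mthX.
  - by rewrite inE; exact: (measurableU _ _ (mdev _ a mcos) (mdev _ b msin)).
  - move=> w /=; rewrite empirical_mean_expiE card_ord => dev.
    have sumE (f : 'I_N -> R) c :
        `|\sum_r (f r - c)| = N%:R * `|N%:R^-1 * \sum_r f r - c|.
      have Nn0 : N%:R != 0 :> R by rewrite pnatr_eq0 -lt0n.
      rewrite -[X in X * _]ger0_norm// -normrM; congr `|_|.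
      by rewrite sumrB sumr_const card_ord mulrBr mulrA divff// mul1r mulr_natl.
    rewrite !sumE !ler_pM2l ?ltr0n//.
    apply/orP; rewrite !leNgt -negb_and; apply/negP => /andP[].
    move: dev; rewrite /=; set A := _ - a; set B := _ - b => dev As Bs.
    have /negP[] : ~~ (eps ^+ 2 < A ^+ 2 + B ^+ 2); last first.
      move: dev; rewrite -ltr_sqr ?nnegrE ?sqrtr_ge0 ?(ltW eps0)//.
      by rewrite sqr_sqrtr// addr_ge0// sqr_ge0.
    rewrite -leNgt.
    have -> : eps ^+ 2 = s ^+ 2 + s ^+ 2 by rewrite s2; field.
    rewrite -(real_normK (num_real A)) -(real_normK (num_real B)).
    by rewrite lerD// lerXn2r// ?nnegrE ltW.
apply: le_trans (measureU2 _ (mdev _ a mcos) (mdev _ b msin)) _.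
apply: le_trans (leeD Hcos Hsin) _.
rewrite -EFinD lee_fin card_ord s2 -mulrDl.
by rewrite le_eqVlt; apply/orP; left; apply/eqP; congr (_ * expR _); field.
Qed.

Lemma cexpectation_law d d' (Omega : measurableType d)
    (T : measurableType d') (R : realType) (P : probability Omega R)
    (gamma : probability T R) (X : {RV P >-> T}) (th : T -> R) :
  (forall A, measurable A -> distribution P X A = gamma A) ->
  measurable_fun setT th ->
  cexpectation P (fun w => expi (th (X w))) =
  cexpectation gamma (fun x => expi (th x)).
Proof.
move=> lawX mth.
have transfer (f : R -> R) : measurable_fun setT f -> (forall x, `|f x| <= 1) ->
    \int[P]_w f (th (X w)) = \int[gamma]_x f (th x).
  move=> mf f1; rewrite /Rintegral; congr fine.
  have mfth : measurable_fun setT (f \o th) by exact: measurableT_comp.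
  transitivity (\int[distribution P X]_x (f (th x))%:E)%E; last first.
    by apply: eq_measure_integral => A mA _; exact: lawX.
  rewrite integral_distribution//; first exact/measurable_EFinP.
  apply: (@probability_bounded_integrable _ _ _ P 1) => //.
  exact: (measurableT_comp mfth).
rewrite /cexpectation /expi /=; congr (_ +i* _)%C; apply: transfer.
- apply: continuous_measurable_fun; exact: continuous_cos.
- by move=> x; rewrite ler_norml cos_geN1 cos_le1.
- apply: continuous_measurable_fun; exact: continuous_sin.
- by move=> x; rewrite ler_norml sin_geN1 sin_le1.
Qed.

(** * Inner products as random variables *)

Lemma continuous_dot (R : realType) (h : ell2 R) : continuous (dot h).
Proof.
move=> x; apply/(@cvgrPdist_lt _ _ _ (nbhs x)) => e e0.
have c0 : 0 < `|h| + 1 by rewrite ltr_wpDl.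
near=> y.
have -> : dot h x - dot h y = dot h (x - y).
  by rewrite dotDr -(scaleN1r y) dotZr mulN1r.
apply: (@le_lt_trans _ _ (`|h| * `|x - y|)).
  rewrite -ler_sqr ?nnegrE ?mulr_ge0// exprMn !sqr_ell2_norm.
  by rewrite real_normK ?num_real// cauchy_schwarz.
apply: (@le_lt_trans _ _ ((`|h| + 1) * `|x - y|)).
  by rewrite ler_wpM2r// lerDl.
rewrite mulrC -ltr_pdivlMr//.
near: y; apply: cvgr_dist_lt => //; exact: divr_gt0.
Unshelve. all: by end_near. Qed.

Lemma measurable_dot (R : realType) (h : ell2 R) :
  measurable_fun [set: borel_ell2 R] (dot h).
Proof.
apply: (measurability _ (RGenOpens.measurableE R)).
move=> _ [_ [a [b ->] <-]]; rewrite setTI; apply: sub_sigma_algebra.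
by have /continuousP := @continuous_dot R h; apply; exact: interval_open.
Qed.

(** * Uniform deviation of the empirical kernel *)

Theorem lemma4p8 (R : realType) (M : metric_pair R)
  (sepM : separable_space (collapse M))
  (ndM : ~ uniformly_discrete (collapse M))
  (B : completeNormedModType R) (iota : completion M B)
  (D : covariance_data B) (gamma : probability (borel_ell2 R) R)
  (gaussian : gaussian_measure D gamma)
  (t : R) (t_gt0 : 0 < t) (N : nat) (N_ge1 : (1 <= N)%N)
  (d : measure_display) (Omega : measurableType d) (P : probability Omega R)
  (u : 'I_N -> {RV P >-> borel_ell2 R})
  (u_indep : independent_rvs u)
  (u_law : forall (r : 'I_N) (A : set (borel_ell2 R)),
    measurable A -> distribution P (u r) A = gamma A)
  (S : {fset B}) (eps : R) (eps_gt0 : 0 < eps) :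
  (P [set w | (eps < \big[Num.max/0]_(x <- S) \big[Num.max/0]_(y <- S)
       Normc.normc (empirical_kernel D t (fun r => u r w) x y
                    - (cov_kernel D t x y)%:C%C))%R]
   <= (4 * #|` S|%:R ^+ 2 * expR (- (N%:R * eps ^+ 2 / 4)))%:E)%E.
Proof.
pose dev x y w := Normc.normc (empirical_kernel D t (fun r => u r w) x y
  - (cov_kernel D t x y)%:C%C).
pose th x y (v : borel_ell2 R) := Num.sqrt t * dot (J D (x - y)) v.
have mth x y : measurable_fun setT (th x y).
  by apply: measurable_funM => //; exact: measurable_dot.
have mdev x y : measurable_fun setT (dev x y).
  apply: measurable_empirical_deviation => r.
  exact: (measurableT_comp (mth x y)).
have dev_le x y : (P [set w | eps < dev x y w]%R <=
    (4 * expR (- (N%:R * eps ^+ 2 / 4)))%:E)%E.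
  apply: (empirical_charfun_deviation N_ge1 u_indep (mth x y)) => // r.
  rewrite (cexpectation_law (u_law r) (mth x y)).
  by rewrite (cov_kernelE _ _ gaussian (ltW t_gt0)).
apply: (@le_trans _ _ (\sum_(p \in [set` (S `*` S)%fset])
    P [set w | eps < dev p.1 p.2 w]%R)%E).
  apply: content_sub_fsum => //.
  - by move=> p _; apply: measurable_strict_superlevel; exact: mdev.
  - apply: measurable_strict_superlevel; apply: measurable_bigmaxr => x.
    by apply: measurable_bigmaxr => y; exact: mdev.
  (* As [eps] is positive, the default value [0] of the two maxima cannot
     exceed it: some pair must. *)
  - move=> w /= dev_gt; apply: contrapT => nodev.
    move: dev_gt; apply/negP; rewrite -leNgt.
    rewrite big_seq; apply: bigmax_le => [|x xS]; first exact: ltW.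
    rewrite big_seq; apply: bigmax_le => [|y yS]; first exact: ltW.
    rewrite leNgt; apply/negP => lt_dev; apply: nodev.
    by exists (x, y) => //=; rewrite in_fsetM xS.
rewrite fsbig_finite//= set_fsetK.
apply: (@le_trans _ _ (\sum_(p <- (S `*` S)%fset)
    (4 * expR (- (N%:R * eps ^+ 2 / 4)))%:E)%E).
  by apply: lee_sum => p _; exact: dev_le.
rewrite sumEFin lee_fin big_const_seq count_predT iter_addr_0.
rewrite -[leLHS]mulr_natr mulrAC ler_wpM2r ?expR_ge0// ler_wpM2l//.
rewrite -natrX ler_nat -mulnn -(size_allpairs pair); apply: uniq_leq_size.
  exact: fset_uniq.
by move=> [x y]; rewrite in_fsetM => /andP[xS yS]; exact: allpairs_f.
Qed.
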